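(* Let $G$ be a finite group generated by pseudoreflections on $\mathbb{C}^n$, let $\Omega\subseteq\mathbb{C}^n$ be a bounded $G$-invariant domain and let $\mathcal{H}\subseteq\mathcal{O}(\Omega)$ be an analytic Hilbert module over $\mathbb{C}[\boldsymbol z]$ with a $G$-invariant reproducing kernel. If $\varrho,\varrho'\in\widehat G$ are such that $\deg\varrho\neq\deg\varrho'$, then: (1) $\mathbb{P}_\varrho\mathcal{H}$ and $\mathbb{P}_{\varrho'}\mathcal{H}$ are not unitarily equivalent submodules over the ring $\mathbb{C}[\boldsymbol z]^G$ of $G$-invariant polynomials; (2) the submodules $\mathbb{P}_\varrho^{ii}\mathcal{H}$ and $\mathbb{P}_{\varrho'}^{jj}\mathcal{H}$ over $\mathbb{C}[\boldsymbol z]^G$ are not unitarily equivalent for any $i,j$ with $1\le i\le\deg\varrho$ and $1\le j\le\deg\varrho'$. (3) However, for any $\varrho\in\widehat G$ and any $i,j$ with $1\le i,j\le\deg\varrho$, the submodules $\mathbb{P}_\varrho^{ii}\mathcal{H}$ and $\mathbb{P}_\varrho^{jj}\mathcal{H}$ over $\mathbb{C}[\boldsymbol z]^G$ are unitarily equivalent.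
   Context: A pseudoreflection on $\mathbb{C}^n$ is a linear map $\rho$ of finite order in $GL(n,\mathbb{C})$ such that $I_n-\rho$ has rank $1$. $\Omega$ is $G$-invariant if $\sigma(\Omega)=\Omega$ for all $\sigma\in G$. $\mathbb{C}[\boldsymbol z]=\mathbb{C}[z_1,\ldots,z_n]$ and $\mathbb{C}[\boldsymbol z]^G$ is its subring of $G$-invariant polynomials. An analytic Hilbert module $\mathcal{H}\subseteq\mathcal{O}(\Omega)$ over $\mathbb{C}[\boldsymbol z]$ is a Hilbert space of holomorphic functions on $\Omega$ with a reproducing kernel $K$, on which multiplication by each polynomial is bounded, and which contains $\mathbb{C}[\boldsymbol z]$ as a dense subspace. $K$ is $G$-invariant if $K(\sigma\boldsymbol z,\sigma\boldsymbol w)=K(\boldsymbol z,\boldsymbol w)$ for all $\sigma\in G$, $\boldsymbol z,\boldsymbol w\in\Omega$. $\mathcal H$ is viewed as a Hilbert module over $\mathbb{C}[\boldsymbol z]^G$ by pointwise multiplication. $\widehat G$ is the set of equivalence classes of irreducible (complex, finite-dimensional) representations of $G$; $\chi_\varrho$ and $\deg\varrho$ are the character and dimension of $\varrho$. For each $\varrho\in\widehat G$ fix a unitary matrix representation $\boldsymbol\pi_\varrho(\sigma)=(\boldsymbol\pi_\varrho^{ij}(\sigma))_{i,j=1}^{\deg\varrho}$ in the class $\varrho$. For $f\in\mathcal{H}$, $$\mathbb{P}_\varrho f=\frac{\deg\varrho}{|G|}\sum_{\sigma\in G}\chi_\varrho(\sigma^{-1})(f\circ\sigma^{-1}),\qquad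 \mathbb{P}_\varrho^{ii}f=\frac{\deg\varrho}{|G|}\sum_{\sigma\in G}\boldsymbol\pi_\varrho^{ii}(\sigma^{-1})(f\circ\sigma^{-1}).$$ These are orthogonal projections on $\mathcal H$ whose ranges are reducing submodules of $\mathcal H$ over $\mathbb{C}[\boldsymbol z]^G$. Two submodules $\mathcal{M},\mathcal{N}$ are unitarily equivalent over $\mathbb{C}[\boldsymbol z]^G$ if there is a unitary $U:\mathcal{M}\to\mathcal{N}$ with $U(pf)=pU(f)$ for all $p\in\mathbb{C}[\boldsymbol z]^G$, $f\in\mathcal{M}$. *)

(* Defs.v *)
From HB Require Import structures.
From mathcomp Require Import all_boot all_order all_algebra all_fingroup.
From mathcomp Require Import mxrepresentation spectral complex.
From mathcomp Require Import all_classical all_reals all_analysis.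
(* mpoly is not imported: its notations clash with those of MathComp-Analysis. *)
From mathcomp Require mpoly.

Set Implicit Arguments.
Unset Strict Implicit.
Unset Printing Implicit Defensive.

Import Order.TTheory GRing.Theory Num.Theory.
Import numFieldNormedType.Exports.
Local Open Scope classical_set_scope.
Local Open Scope ring_scope.

(* The ascription makes R[i] inherit the topology and the norm that
   MathComp-Analysis puts on every numClosedFieldType. *)
Definition CC (R : realType) : numClosedFieldType := R[i].

Section FunctionSpaces.
Variables (R : realType) (n : nat).
Local Notation C := (CC R).
Local Notation cpoly := (mpoly.mpoly n C).
Implicit Types (Omega : set 'cV[C]_n).

Definition peval (p : cpoly) (z : 'cV[C]_n) : C :=
  mpoly.meval (fun i => z i 0) p.

Definition complex_domain Omega :=
  [/\ open Omega, connected Omega & Omega !=set0].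

(* Complex Frechet differentiability: the scalar field of 'cV[C]_n is C. *)
Definition holomorphic_on Omega (f : 'cV[C]_n -> C) :=
  forall z, Omega z -> differentiable (f : 'cV[C]_n -> C^o) z.

Definition ip_norm (ip : ('cV[C]_n -> C) -> ('cV[C]_n -> C) -> C)
    (f : 'cV[C]_n -> C) : C := sqrtC (ip f f).

(* A function on Omega is encoded as the function on C^n that extends it by 0;
   the values of the inner product outside the carrier are irrelevant. *)
Record hilbert_fun_space Omega := HilbertFunSpace {
  hcarrier : set ('cV[C]_n -> C);
  hinner : ('cV[C]_n -> C) -> ('cV[C]_n -> C) -> C;
  hsupport : forall f, hcarrier f -> forall z, ~ Omega z -> f z = 0;
  hzero : hcarrier (fun=> 0);
  hlin : forall a f g, hcarrier f -> hcarrier g -> hcarrier (a \*o f \+ g);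
  hinner_lin : forall a f g h, hcarrier f -> hcarrier g -> hcarrier h ->
    hinner (a \*o f \+ g) h = a * hinner f h + hinner g h;
  hinner_conj : forall f g, hcarrier f -> hcarrier g ->
    hinner g f = Num.conj (hinner f g);
  hinner_ge0 : forall f, hcarrier f -> 0 <= hinner f f;
  hinner_def : forall f, hcarrier f -> hinner f f = 0 -> f = (fun=> 0);
  hcomplete : forall u : nat -> 'cV[C]_n -> C, (forall k, hcarrier (u k)) ->
    (forall e : C, 0 < e -> exists N, forall k l, (N <= k)%N -> (N <= l)%N ->
       ip_norm hinner (u k \- u l) < e) ->
    exists2 f, hcarrier f &
      forall e : C, 0 < e -> exists N, forall k, (N <= k)%N ->
        ip_norm hinner (u k \- f) < e
}.

(* The values K z w with w outside Omega are irrelevant. *)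
Definition reproducing_kernel Omega (H : hilbert_fun_space Omega)
    (K : 'cV[C]_n -> 'cV[C]_n -> C) :=
  forall w, Omega w ->
    hcarrier H (K ^~ w) /\ forall f, hcarrier H f -> hinner H f (K ^~ w) = f w.

Definition analytic_hilbert_module Omega (H : hilbert_fun_space Omega)
    (K : 'cV[C]_n -> 'cV[C]_n -> C) :=
  [/\ forall f, hcarrier H f -> holomorphic_on Omega f,
      reproducing_kernel H K,
      forall p : cpoly, exists c : C, forall f, hcarrier H f ->
        hcarrier H (peval p \* f) /\
        ip_norm (hinner H) (peval p \* f) <= c * ip_norm (hinner H) f,
      forall p : cpoly, hcarrier H (peval p \_ Omega) &
      forall f, hcarrier H f -> forall e : C, 0 < e ->
        exists p : cpoly, ip_norm (hinner H) (f \- (peval p \_ Omega)) < e].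

End FunctionSpaces.

Section Actions.
Variables (R : realType) (n : nat) (gT : finGroupType) (G : {group gT}).
Local Notation C := (CC R).

Definition pseudoreflection (A : 'M[C]_n) :=
  [/\ A \in unitmx, (exists2 k, (0 < k)%N & A ^+ k = 1%:M) &
      \rank (1%:M - A) = 1%N].

(* A finite subgroup of GL(n, C) is given by the faithful representation rG of
   the abstract finite group G; s acts on column vectors by z |-> rG s *m z. *)
Variable rG : mx_representation C G n.

Definition pseudoreflection_group :=
  mx_faithful rG /\
  (G :=: <<[set s in G | `[< pseudoreflection (rG s) >]]>>)%g.

Definition invariant_domain (Omega : set 'cV[C]_n) :=
  forall s, s \in G -> (fun z => rG s *m z) @` Omega = Omega.

Definition invariant_kernel (Omega : set 'cV[C]_n)
    (K : 'cV[C]_n -> 'cV[C]_n -> C) :=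
  forall s z w, s \in G -> Omega z -> Omega w ->
    K (rG s *m z) (rG s *m w) = K z w.

Definition invariant_poly (p : mpoly.mpoly n C) :=
  forall s z, s \in G -> peval p (rG s *m z) = peval p z.

Record unitary_irrep := UnitaryIrrep {
  irr_deg : nat;
  irr_rep :> mx_representation C G irr_deg;
  irr_irreducible : mx_irreducible irr_rep;
  irr_unitary : forall s, s \in G -> irr_rep s \is unitarymx
}.

Implicit Types (rho : unitary_irrep) (f : 'cV[C]_n -> C).

Definition irr_char rho (s : gT) : C := \tr (rho s).

Definition isotypic_proj rho f : 'cV[C]_n -> C := fun z =>
  (irr_deg rho)%:R / #|G|%:R *
    \sum_(s in G) irr_char rho (s^-1)%g * f (rG (s^-1)%g *m z).

Definition diag_proj rho (i : 'I_(irr_deg rho)) f : 'cV[C]_n -> C := fun z =>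
  (irr_deg rho)%:R / #|G|%:R *
    \sum_(s in G) rho (s^-1)%g i i * f (rG (s^-1)%g *m z).

Definition unitarily_equivalent Omega (H : hilbert_fun_space Omega)
    (M N : set ('cV[C]_n -> C)) :=
  exists U : ('cV[C]_n -> C) -> ('cV[C]_n -> C),
    [/\ U @` M = N,
        forall a f g, M f -> M g -> U (a \*o f \+ g) = a \*o U f \+ U g,
        forall f g, M f -> M g -> hinner H (U f) (U g) = hinner H f g &
        forall p f, invariant_poly p -> M f -> U (peval p \* f) = peval p \* U f].

End Actions.

(* Main.v *)
Require Import Defs.
From mathcomp Require Import all_boot all_order all_algebra all_fingroup.
From mathcomp Require Import mxrepresentation spectral complex ring.
From mathcomp Require Import all_classical all_reals all_analysis.
From mathcomp Require mpoly.
Set Implicit Arguments.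
Unset Strict Implicit.
Unset Printing Implicit Defensive.
Import Order.TTheory GRing.Theory Num.Theory.
Import numFieldNormedType.Exports.
Import (canonicals, coercions) mpoly.
Local Open Scope classical_set_scope.
Local Open Scope ring_scope.

(** A unitary module map from M to N carries the joint eigenspace of M at a
   point w, the f in M with <p g, f> = p(w) <g, f> for all invariant p and all
   g in M, onto that of N. Its dimension is therefore an invariant of M, and the
   submodules in question are told apart by computing it at a suitable w
   (equivalent_eigenspace_card).

   Take w in Omega with a free orbit. A polynomial q that vanishes on the orbit
   becomes, after multiplication by some invariant polynomial D with D(w) <> 0, a
   combination of invariant polynomials vanishing at w: this is the Galois
   descent identity, proved with a linear form L that separates the orbit
   (ip_orbit_product, ip_vanish_orbit). Hence an f in the joint eigenspace of H
   pairs with a polynomial only through the values of the latter on the orbit,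
   and by density of the polynomials f is a combination of the kernel functions
   at the points of the orbit (eigenspace_kernel_span). These functions are
   permuted by G, like a basis of the regular representation.

   The matrix coefficients of rho define operators T_ij on H, with T_ii = P^ii.
   Schur orthogonality gives the relations of matrix units (coef_op_mul), and
   T_ij^* = T_ji because rho is unitary and composition with an element of G is
   unitary on H (gcomp_unitary, where the invariance of the kernel enters). So
   T_ij is a unitary module map between the ranges of P^ii and P^jj, which is the
   positive part of the theorem. Further, for a set J of indices, the joint
   eigenspace at w of the range of the sum of the P^ii with i in J has the basis
   T_ki K_w, with k arbitrary and i in J (block_kernel_basis). Its dimension is
   deg rho for one P^ii, and (deg rho)^2 for the isotypic projection; either
   number determines deg rho. *)

(** * Hilbert spaces of functions *)

Section ComplexOrder.
Variable R : realType.
Local Notation C := (CC R).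

Lemma eq0_of_small (x : C) : (forall e : C, 0 < e -> `|x| < e) -> x = 0.
Proof.
move=> small; apply/eqP; apply: contraT => x0.
by have := small `|x|; rewrite normr_gt0 x0 ltxx => /(_ isT).
Qed.

Lemma invS_small (e : C) : 0 < e ->
  exists N, forall k, (N <= k)%N -> k.+1%:R^-1 < e.
Proof.
move=> e0.
have [r r0 er] : exists2 r : R, 0 < r & e = real_complex R r.
  have /complex_realP[r er] : (e : R[i]) \is Num.real by exact: gtr0_real.
  by exists r => //; rewrite -ltcR -er.
exists (Num.truncn r^-1) => k Nk.
rewrite er; have -> : (k.+1%:R^-1 : C) = real_complex R k.+1%:R^-1.
  by rewrite fmorphV rmorph_nat.
rewrite ltcR invf_plt ?posrE ?ltr0n //.
apply: lt_le_trans (truncnS_gt _) _; by rewrite ler_nat.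
Qed.

(** The order of C is partial, but nonnegative elements are real, so that infima
   exist by completeness of R. *)
Lemma exists_inf (S : set C) : S !=set0 -> (forall x, S x -> 0 <= x) ->
  exists d : C, (forall x, S x -> d <= x) /\
    forall e : C, 0 < e -> exists2 x, S x & x < d + e.
Proof.
move=> [x0 Sx0] S0; pose T : set R := fun r => S (real_complex R r).
have ST x : S x -> exists2 r : R, T r & x = real_complex R r.
  move=> Sx; have /complex_realP[r er] : (x : R[i]) \is Num.real.
    exact: ger0_real (S0 _ Sx).
  by exists r => //; rewrite /T -er.
have lbT : has_lbound T.
  by exists 0 => r /S0 /=; rewrite -(ler0c r).
have infT : has_inf T by split=> //; have [r Tr _] := ST _ Sx0; exists r.
exists (real_complex R (inf T)); split=> [x /ST[r Tr ->]|e e0].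
  by rewrite lecR; apply: ge_inf.
have [r r0 er] : exists2 r : R, 0 < r & e = real_complex R r.
  have /complex_realP[r er] : (e : R[i]) \is Num.real by exact: gtr0_real.
  by exists r => //; rewrite -ltcR -er.
have [t Tt tr] := inf_adherent r0 infT.
by exists (real_complex R t) => //; rewrite er -rmorphD ltcR.
Qed.

End ComplexOrder.

Section HilbertFunctionSpace.
Variables (R : realType) (n : nat) (Omega : set 'cV[CC R]_n).
Variable H : hilbert_fun_space Omega.
Local Notation C := (CC R).
Local Notation HH := (hcarrier H).
Local Notation "<< f , g >>" := (hinner H f g).
Local Notation "''N' f" := (ip_norm (hinner H) f) (at level 10, f at level 8).
Implicit Types (f g h : 'cV[C]_n -> C).

Lemma hcarrierD f g : HH f -> HH g -> HH (f \+ g).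
Proof.
move=> Hf Hg; have := hlin 1 Hf Hg.
by congr hcarrier; apply/funext => z /=; rewrite mul1r.
Qed.

Lemma hcarrierZ a f : HH f -> HH (a \*o f).
Proof.
move=> Hf; have := hlin a Hf (hzero H).
by congr hcarrier; apply/funext => z /=; rewrite addr0.
Qed.

Lemma hcarrierB f g : HH f -> HH g -> HH (f \- g).
Proof.
move=> Hf Hg; have := hlin (-1) Hg Hf.
by congr hcarrier; apply/funext => z /=; rewrite mulN1r addrC.
Qed.

Lemma hinner0l h : HH h -> << (fun=> 0), h >> = 0.
Proof.
move=> Hh; have := hinner_lin 1 (hzero H) (hzero H) Hh.
set f := (X in << X, _ >>); have -> : f = (fun=> 0).
  by apply/funext => z; rewrite /f /= mulr0 addr0.
rewrite mul1r => e; apply: (@addrI _ << (fun=> 0), h >>).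
by rewrite -e addr0.
Qed.

Lemma hinnerDl f g h : HH f -> HH g -> HH h ->
  << f \+ g, h >> = << f, h >> + << g, h >>.
Proof.
move=> Hf Hg Hh; rewrite -[<< f, h >>]mul1r -hinner_lin //.
by congr hinner; apply/funext => z /=; rewrite mul1r.
Qed.

Lemma hinnerZl a f h : HH f -> HH h -> << a \*o f, h >> = a * << f, h >>.
Proof.
move=> Hf Hh; rewrite -[RHS]addr0 -(hinner0l Hh) -hinner_lin //; last exact: hzero.
by congr hinner; apply/funext => z /=; rewrite addr0.
Qed.

Lemma hinnerBl f g h : HH f -> HH g -> HH h ->
  << f \- g, h >> = << f, h >> - << g, h >>.
Proof.
move=> Hf Hg Hh; rewrite addrC -mulN1r -hinner_lin //.
by congr hinner; apply/funext => z /=; rewrite mulN1r addrC.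
Qed.

Lemma hinnerZr a f h : HH f -> HH h -> << h, a \*o f >> = Num.conj a * << h, f >>.
Proof.
move=> Hf Hh; have HZ := hcarrierZ a Hf.
by rewrite (hinner_conj HZ Hh) hinnerZl // rmorphM /= -(hinner_conj Hf Hh).
Qed.

Lemma hinnerBr f g h : HH f -> HH g -> HH h ->
  << h, f \- g >> = << h, f >> - << h, g >>.
Proof.
move=> Hf Hg Hh; have HB := hcarrierB Hf Hg.
rewrite (hinner_conj HB Hh) hinnerBl // rmorphB /=.
by rewrite -(hinner_conj Hf Hh) -(hinner_conj Hg Hh).
Qed.

Lemma hinnerDr f g h : HH f -> HH g -> HH h ->
  << h, f \+ g >> = << h, f >> + << h, g >>.
Proof.
move=> Hf Hg Hh; have HB := hcarrierD Hf Hg.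
rewrite (hinner_conj HB Hh) hinnerDl // rmorphD /=.
by rewrite -(hinner_conj Hf Hh) -(hinner_conj Hg Hh).
Qed.

Section Sums.
Variables (I : Type) (r : seq I) (P : pred I) (c : I -> C) (F : I -> 'cV[C]_n -> C).
Hypothesis HF : forall i, P i -> HH (F i).

Lemma hcarrier_sum : HH (fun z => \sum_(i <- r | P i) c i * F i z).
Proof.
elim: r => [|i s IH].
  by have := hzero H; congr hcarrier; apply/funext => z; rewrite big_nil.
case Pi: (P i); last first.
  by move: IH; congr hcarrier; apply/funext => z; rewrite big_cons Pi.
have := hlin (c i) (HF Pi) IH.
by congr hcarrier; apply/funext => z /=; rewrite big_cons Pi.
Qed.

End Sums.

Lemma hinner_suml (I : Type) (r : seq I) (P : pred I) (c : I -> C)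
    (F : I -> 'cV[C]_n -> C) h :
  (forall i, P i -> HH (F i)) -> HH h ->
  << (fun z => \sum_(i <- r | P i) c i * F i z), h >> =
  \sum_(i <- r | P i) c i * << F i, h >>.
Proof.
move=> HF Hh; elim: r => [|i s IH].
  rewrite big_nil -[RHS](hinner0l Hh); congr hinner.
  by apply/funext => z; rewrite big_nil.
rewrite big_cons; case Pi: (P i); last first.
  by rewrite -IH; congr hinner; apply/funext => z; rewrite big_cons Pi.
rewrite -IH -hinner_lin //; first last.
- exact: hcarrier_sum.
- exact: HF.
by congr hinner; apply/funext => z; rewrite big_cons Pi.
Qed.

Lemma hinner_sumr (I : Type) (r : seq I) (P : pred I) (c : I -> C)
    (F : I -> 'cV[C]_n -> C) h :
  (forall i, P i -> HH (F i)) -> HH h ->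
  << h, (fun z => \sum_(i <- r | P i) c i * F i z) >> =
  \sum_(i <- r | P i) Num.conj (c i) * << h, F i >>.
Proof.
move=> HF Hh; have HS := hcarrier_sum r c HF.
rewrite (hinner_conj HS Hh) hinner_suml // rmorph_sum /=.
by apply: eq_bigr => i Pi; rewrite rmorphM /= -(hinner_conj (HF i Pi) Hh).
Qed.

Lemma hinner_gt0 f : HH f -> (0 < << f, f >>) = (<< f, f >> != 0).
Proof. by move=> Hf; rewrite lt_def hinner_ge0 // andbT. Qed.

(** Pythagoras for the projection of h on the line of d. Nonnegativity of the
   left side is the Cauchy-Schwarz inequality; comparing it with a minimal
   distance bounds << h, d >>, as used for nearest points. *)
Lemma hinner_residual h d : HH h -> HH d -> << d, d >> != 0 ->
  let r := h \- ((<< h, d >> / << d, d >>) \*o d) in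
  << r, r >> = << h, h >> - `|<< h, d >>| ^+ 2 / << d, d >>.
Proof.
move=> Hh Hd d0 r; rewrite /r.
have Ha := hcarrierZ (<< h, d >> / << d, d >>) Hd.
have Hr := hcarrierB Hh Ha.
rewrite hinnerBl // hinnerZl // !hinnerBr // !hinnerZr //.
rewrite rmorphM /= fmorphV /= -(hinner_conj Hd Hd) -(hinner_conj Hh Hd) normCK.
rewrite -(hinner_conj Hh Hd); field.
exact: d0.
Qed.

Lemma cauchy_schwarz f g : HH f -> HH g ->
  `|<< f, g >>| ^+ 2 <= << f, f >> * << g, g >>.
Proof.
move=> Hf Hg; have [g0|g0] := eqVneq << g, g >> 0.
  rewrite (hinner_def Hg g0) (hinner_conj (hzero H) Hf) hinner0l //.
  by rewrite rmorph0 normr0 expr0n /= hinner0l ?mulr0 //; exact: hzero.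
have := hinner_ge0 (hcarrierB Hf (hcarrierZ (<< f, g >> / << g, g >>) Hg)).
rewrite hinner_residual // subr_ge0 ler_pdivrMr // hinner_gt0 //.
Qed.

Lemma ip_norm_ge0 f : HH f -> 0 <= 'N f.
Proof. by move=> Hf; rewrite sqrtC_ge0 hinner_ge0. Qed.

Lemma ip_normB f g : HH f -> HH g -> 'N (f \- g) = 'N (g \- f).
Proof.
move=> Hf Hg; congr sqrtC.
have HB := hcarrierB Hf Hg.
have -> : g \- f = (-1) \*o (f \- g).
  by apply/funext => z /=; rewrite mulN1r opprB.
rewrite hinnerZl // ?hinnerZr //; last exact: hcarrierZ.
by rewrite rmorphN rmorph1 !mulN1r opprK.
Qed.

Lemma norm_hinner_le f g : HH f -> HH g -> `|<< f, g >>| <= 'N f * 'N g.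
Proof.
move=> Hf Hg; rewrite -(@ler_pXn2r _ 2) // ?nnegrE ?mulr_ge0 ?ip_norm_ge0 //.
by rewrite exprMn !sqrtCK cauchy_schwarz.
Qed.

Lemma ip_normD f g : HH f -> HH g -> 'N (f \+ g) <= 'N f + 'N g.
Proof.
move=> Hf Hg; have HD := hcarrierD Hf Hg.
rewrite -(@ler_pXn2r _ 2) // ?nnegrE ?addr_ge0 ?ip_norm_ge0 //.
rewrite sqrtCK sqrrD !sqrtCK hinnerDl // !hinnerDr // addrA lerD2r -addrA lerD2l.
rewrite (hinner_conj Hf Hg).
have re2 (x : C) : x + Num.conj x <= `|x| *+ 2.
  have re : x + Num.conj x \is Num.real.
    by rewrite CrealE rmorphD /= conjCK addrC.
  apply: le_trans (real_ler_norm re) _.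
  by apply: le_trans (ler_normD _ _) _; rewrite norm_conjC mulr2n.
by apply: le_trans (re2 _) _; rewrite lerMn2r /= norm_hinner_le.
Qed.

Definition hcvg (u : nat -> 'cV[C]_n -> C) f :=
  forall e : C, 0 < e -> exists N, forall k, (N <= k)%N -> 'N (u k \- f) < e.

Lemma hinner_cvg u f g : (forall k, HH (u k)) -> HH f -> HH g -> hcvg u f ->
  forall e : C, 0 < e ->
    exists N, forall k, (N <= k)%N -> `|<< u k, g >> - << f, g >>| < e.
Proof.
move=> Hu Hf Hg uf e e0.
have g0 : 0 < 'N g + 1 by rewrite ltr_wpDl ?ip_norm_ge0.
have [N uN] := uf _ (divr_gt0 e0 g0); exists N => k /uN uk.
rewrite -hinnerBl //; apply: le_lt_trans (norm_hinner_le _ Hg) _.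
  exact: hcarrierB.
rewrite ltr_pdivlMr // in uk; apply: le_lt_trans uk.
by rewrite ler_wpM2l ?lerDl ?ler01 ?ip_norm_ge0 //; exact: hcarrierB.
Qed.

Lemma hinner_cvg_eq u f g v f' g' :
  (forall k, HH (u k)) -> HH f -> HH g -> hcvg u f ->
  (forall k, HH (v k)) -> HH f' -> HH g' -> hcvg v f' ->
  (forall k, << u k, g >> = << v k, g' >>) -> << f, g >> = << f', g' >>.
Proof.
move=> Hu Hf Hg uf Hv Hf' Hg' vf uv; apply/subr0_eq/eq0_of_small => e e0.
have e2 : 0 < e / 2 by rewrite divr_gt0.
have [N uN] := hinner_cvg Hu Hf Hg uf e2.
have [M vM] := hinner_cvg Hv Hf' Hg' vf e2.
have := uN _ (leq_maxl N M); have := vM _ (leq_maxr N M).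
rewrite uv; set x := << v _, g' >> => xM xN.
have -> : << f, g >> - << f', g' >> = (x - << f', g' >>) - (x - << f, g >>) by ring.
rewrite [e](splitr e); apply: le_lt_trans (ler_normB _ _) _; exact: ltrD.
Qed.

Lemma parallelogram f g : HH f -> HH g ->
  << f \- g, f \- g >> + << f \+ g, f \+ g >> =
  2 * << f, f >> + 2 * << g, g >>.
Proof.
move=> Hf Hg; have HB := hcarrierB Hf Hg; have HD := hcarrierD Hf Hg.
rewrite hinnerBl // !hinnerBr // hinnerDl // !hinnerDr //; ring.
Qed.

(** The density half of the projection theorem: elements of D at nearly minimal
   distance from f form a Cauchy sequence by the parallelogram law, and subtracting its
   limit from f leaves a vector orthogonal to D, hence 0. *)
Lemma hdense (D : set ('cV[C]_n -> C)) :
  D `<=` HH -> D (fun=> 0) -> (forall a f g, D f -> D g -> D (a \*o f \+ g)) ->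
  (forall h, HH h -> (forall d, D d -> << h, d >> = 0) -> h = (fun=> 0)) ->
  forall f, HH f -> exists2 u : nat -> 'cV[C]_n -> C, (forall k, D (u k)) & hcvg u f.
Proof.
move=> DH D0 Dlin Dperp f Hf.
pose q d := << f \- d, f \- d >>.
have [delta [deltaP deltaI]] : exists d : C, (forall x, (q @` D) x -> d <= x) /\
    forall e : C, 0 < e -> exists2 x, (q @` D) x & x < d + e.
  apply: exists_inf; first by exists (q (fun=> 0)), (fun=> 0).
  by move=> x [d /DH Hd <-]; apply/hinner_ge0/hcarrierB.
have {}deltaP d : D d -> delta <= q d by move=> Dd; apply: deltaP; exists d.
have /choice[u uP] : forall k : nat, exists g, D g /\ q g < delta + k.+1%:R^-1.
  move=> k.
  have [|x [d Dd <-] dx] := deltaI k.+1%:R^-1; first by rewrite invr_gt0 ltr0n.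
  by exists d.
have Du k : D (u k) by case: (uP k).
have uq k : q (u k) < delta + k.+1%:R^-1 by case: (uP k).
have Hu k := DH _ (Du k).
have cauchy k l : << u k \- u l, u k \- u l >> <= 2 * k.+1%:R^-1 + 2 * l.+1%:R^-1.
  have Hk := hcarrierB Hf (Hu k); have Hl := hcarrierB Hf (Hu l).
  have := parallelogram Hl Hk.
  have -> : (f \- u l) \- (f \- u k) = u k \- u l.
    by apply/funext => z /=; ring.
  pose m := 2^-1 \*o (u k \+ u l).
  have Dm : D m.
    have := Dlin 2^-1 _ _ (Dlin 1 _ _ (Du k) (Du l)) D0.
    by congr D; apply/funext => z; rewrite /m /= addr0 mul1r.
  have -> : (f \- u l) \+ (f \- u k) = 2 \*o (f \- m).
    by apply/funext => z; rewrite /m /=; field.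
  have Hm := hcarrierB Hf (DH _ Dm).
  rewrite hinnerZl // ?hinnerZr //; last exact: hcarrierZ.
  rewrite rmorph_nat -!/(q _) => /(canRL (addrK _)) ->.
  have le1 : 4 * delta <= 2 * (2 * q m).
    by rewrite mulrA -natrM ler_pM2l ?ltr0n // deltaP.
  have le2 j : 2 * q (u j) <= 2 * (delta + j.+1%:R^-1).
    by rewrite ler_pM2l ?ltr0n // ltW.
  rewrite lerBlDr; apply: le_trans (lerD (le2 l) (le2 k)) _.
  rewrite -subr_ge0; rewrite -subr_ge0 in le1; apply: le_trans le1 _.
  by rewrite le_eqVlt; apply/orP; left; apply/eqP; ring.
have [|s Hs us] := hcomplete (Hu).
  move=> e e0.
  have [|N NP] := @invS_small R (e ^+ 2 / 4); first by rewrite divr_gt0 // exprn_gt0.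
  exists N => k l /NP Nk /NP Nl.
  rewrite -(@ltr_pXn2r _ 2) ?nnegrE ?(ltW e0) //; last exact/ip_norm_ge0/hcarrierB.
  rewrite sqrtCK; apply: le_lt_trans (cauchy k l) _.
  rewrite -mulrDr; have := ltrD Nk Nl.
  have -> : e ^+ 2 / 4 + e ^+ 2 / 4 = 2^-1 * e ^+ 2 by field.
  by rewrite -ltr_pdivlMl ?invrK // invr_gt0 ltr0n.
have Hfs := hcarrierB Hf Hs.
suff fs : f \- s = (fun=> 0).
  exists u => //; suff -> : f = s by [].
  by apply/funext => z; apply/subr0_eq; have := congr1 (@^~ z) fs.
apply: Dperp => // d Dd; have Hd := DH _ Dd.
have [d0|d0] := eqVneq << d, d >> 0.
  by rewrite (hinner_def Hd d0) (hinner_conj (hzero H) Hfs) hinner0l // conjC0.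
have dgt0 : 0 < << d, d >> by rewrite hinner_gt0.
(* Near-minimality of u k bounds its gain from moving along d. *)
have near k : `|<< f \- u k, d >>| ^+ 2 <= k.+1%:R^-1 * << d, d >>.
  have Hk := hcarrierB Hf (Hu k).
  set a := << f \- u k, d >> / << d, d >>.
  have := deltaP _ (Dlin a _ _ Dd (Du k)); rewrite /q.
  have -> : f \- (a \*o d \+ u k) = (f \- u k) \- (a \*o d).
    by apply/funext => z /=; ring.
  rewrite hinner_residual // => le1; rewrite -ler_pdivrMr //.
  have := le_trans le1 (ltW (_ : _ < delta + k.+1%:R^-1 - _)).
  move=> /(_ (`|<< f \- u k, d >>| ^+ 2 / << d, d >>)); rewrite ltrD2r.
  by move=> /(_ (uq k)); rewrite -addrA lerDl subr_ge0.
apply: eq0_of_small => e e0.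
have e2 : 0 < e / 2 by rewrite divr_gt0.
have [N NP] := hinner_cvg Hu Hs Hd us e2.
have [|M MP] := @invS_small R ((e / 2) ^+ 2 / << d, d >>).
  by rewrite divr_gt0 // exprn_gt0.
set k := maxn N M; have := NP k (leq_maxl _ _); have := MP k (leq_maxr _ _).
rewrite ltr_pdivlMr // => /(le_lt_trans (near k)).
rewrite ltr_pXn2r ?nnegrE ?(ltW e2) // => lt1 lt2.
have -> : << f \- s, d >> = << f \- u k, d >> + (<< u k, d >> - << s, d >>).
  by rewrite !hinnerBl //; ring.
rewrite [e](splitr e); apply: le_lt_trans (ler_normD _ _) _; exact: ltrD.
Qed.

End HilbertFunctionSpace.

(** * Composition with the group elements *)

Section GroupComposition.
Variables (R : realType) (n : nat) (gT : finGroupType) (G : {group gT}).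
Variables (rG : mx_representation (CC R) G n).
Local Notation C := (CC R).
Implicit Types (f g h : 'cV[C]_n -> C) (s t : gT) (z w : 'cV[C]_n).

Definition gcomp s f : 'cV[C]_n -> C := fun z => f (rG s *m z).

Lemma gactM s t z : s \in G -> t \in G -> rG (s * t)%g *m z = rG s *m (rG t *m z).
Proof. by move=> Gs Gt; rewrite repr_mxM // mulmxA. Qed.

Lemma gact1 z : rG 1%g *m z = z.
Proof. by rewrite repr_mx1 mul1mx. Qed.

Lemma gactK s z : s \in G -> rG s^-1%g *m (rG s *m z) = z.
Proof. by move=> Gs; rewrite -gactM ?groupV // mulVg gact1. Qed.

Lemma gactKV s z : s \in G -> rG s *m (rG s^-1%g *m z) = z.
Proof. by move=> Gs; rewrite -gactM ?groupV // mulgV gact1. Qed.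

Lemma gcompK s f : s \in G -> gcomp s^-1%g (gcomp s f) = f.
Proof. by move=> Gs; apply/funext => z; rewrite /gcomp gactKV. Qed.

Variables (Omega : set 'cV[C]_n) (H : hilbert_fun_space Omega).
Variable (K : 'cV[C]_n -> 'cV[C]_n -> C).
Hypothesis hinv : invariant_domain rG Omega.

Lemma domain_act s z : s \in G -> Omega (rG s *m z) <-> Omega z.
Proof.
move=> Gs; split=> Oz; last by rewrite -(hinv Gs); exists z.
have Gs' : s^-1%g \in G by rewrite groupV.
by rewrite -(hinv Gs'); exists (rG s *m z) => //; rewrite gactK.
Qed.

Hypothesis hrep : reproducing_kernel H K.
Hypothesis hK : invariant_kernel rG Omega K.

Local Notation HH := (hcarrier H).
Local Notation "<< f , g >>" := (hinner H f g).

Lemma hcarrier_kernel w : Omega w -> HH (K^~ w).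
Proof. by move=> /hrep[]. Qed.

Lemma hinner_kernel f w : Omega w -> HH f -> << f, K^~ w >> = f w.
Proof. by move=> /hrep[_]; apply. Qed.

Lemma hinner_kernell f w : Omega w -> HH f -> << K^~ w, f >> = Num.conj (f w).
Proof.
move=> Ow Hf; rewrite (hinner_conj Hf (hcarrier_kernel Ow)).
by rewrite hinner_kernel.
Qed.

Lemma hcarrier_eqP f g : HH f -> HH g -> (forall z, Omega z -> f z = g z) -> f = g.
Proof.
move=> Hf Hg fg; apply/funext => z; have [/fg//|nOz] := pselect (Omega z).
by rewrite (hsupport Hf nOz) (hsupport Hg nOz).
Qed.

Lemma gcomp_kernel s w : s \in G -> Omega w ->
  gcomp s (K^~ w) = K^~ (rG s^-1%g *m w).
Proof.
move=> Gs Ow; have Gs' : s^-1%g \in G by rewrite groupV.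
have Osw : Omega (rG s^-1%g *m w) by apply/domain_act.
apply/funext => z; rewrite /gcomp; have [Oz|nOz] := pselect (Omega z).
  by rewrite -[in LHS](gactKV w Gs) hK.
rewrite (hsupport (hcarrier_kernel Ow)) ?(hsupport (hcarrier_kernel Osw)) //.
by move/domain_act => /(_ Gs).
Qed.

(** The f in H that satisfy the conclusion form a subspace D. It contains the
   kernel functions, because the kernel is invariant, so it is dense. The
   adjunction makes composition isometric on D, so it maps an approximating
   sequence of f to a Cauchy sequence, whose limit is the composite of f. *)
Lemma gcomp_unitary s : s \in G -> forall f, HH f ->
  HH (gcomp s f) /\ forall g, HH g -> HH (gcomp s^-1%g g) ->
    << gcomp s f, g >> = << f, gcomp s^-1%g g >>.
Proof.
move=> Gs; have Gs' : s^-1%g \in G by rewrite groupV.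
pose D : set ('cV[C]_n -> C) := fun f => HH f /\ HH (gcomp s f) /\
  forall g, HH g -> HH (gcomp s^-1%g g) ->
    << gcomp s f, g >> = << f, gcomp s^-1%g g >>.
have D0 : D (fun=> 0).
  do ![split; first exact: hzero] => g Hg Hg'.
  by rewrite !hinner0l.
have Dlin a f g : D f -> D g -> D (a \*o f \+ g).
  move=> [Hf [Hsf adjf]] [Hg [Hsg adjg]].
  split; first exact: hlin.
  split; first exact: hlin.
  move=> h Hh Hsh.
  by rewrite (hinner_lin _ Hf) // -adjf // -adjg // -hinner_lin.
have Dker w : Omega w -> D (K^~ w).
  move=> Ow; have Osw : Omega (rG s^-1%g *m w) by apply/domain_act.
  split; first exact: hcarrier_kernel.
  rewrite gcomp_kernel //; split; first exact: hcarrier_kernel.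
  by move=> g Hg Hsg; rewrite !hinner_kernell.
have Dperp h : HH h -> (forall d, D d -> << h, d >> = 0) -> h = (fun=> 0).
  move=> Hh hD; apply: hcarrier_eqP => // [|z Oz]; first exact: hzero.
  by rewrite -hinner_kernel // hD //; apply: Dker.
have isoD f : D f -> << gcomp s f, gcomp s f >> = << f, f >>.
  by move=> [Hf [Hsf ->]]; rewrite ?gcompK.
have DH : D `<=` HH by move=> f [].
move=> f Hf; have [u Du uf] := hdense DH D0 Dlin Dperp Hf.
have Hu k : HH (u k) by case: (Du k).
have Hsu k : HH (gcomp s (u k)) by case: (Du k) => _ [].
have [|g Hg sug] := hcomplete Hsu.
  move=> e e0; have e2 : 0 < e / 2 by rewrite divr_gt0.
  have [N NP] := uf _ e2; exists N => k l Nk Nl.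
  have Dkl : D (u k \- u l).
    have := Dlin (-1) _ _ (Du l) (Du k).
    by congr D; apply/funext => z /=; rewrite mulN1r addrC.
  have -> : gcomp s (u k) \- gcomp s (u l) = gcomp s (u k \- u l) by [].
  rewrite /ip_norm isoD //.
  have -> : u k \- u l = (u k \- f) \+ (f \- u l).
    by apply/funext => z /=; ring.
  have HB := hcarrierB (Hu k) Hf; have HB' := hcarrierB Hf (Hu l).
  rewrite -/(ip_norm (hinner H) _) [e](splitr e).
  apply: le_lt_trans (ip_normD HB HB') _; apply: ltrD; first exact: NP.
  by rewrite ip_normB //; exact: NP.
have gE : g = gcomp s f.
  apply/funext => z; have [Oz|nOz] := pselect (Omega z).
    have Osz : Omega (rG s *m z) by apply/domain_act.
    rewrite -(hinner_kernel Oz Hg) /gcomp -(hinner_kernel Osz Hf).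
    apply: hinner_cvg_eq sug _ _ _ uf _ => //; try exact: hcarrier_kernel.
    by move=> k; rewrite !hinner_kernel.
  rewrite (hsupport Hg nOz) /gcomp (hsupport Hf) //.
  by move/domain_act => /(_ Gs).
rewrite gE in Hg sug; split=> // h Hh Hsh.
apply: hinner_cvg_eq sug _ _ _ uf _ => //.
by move=> k; case: (Du k) => _ [_]; apply.
Qed.

Lemma hcarrier_gcomp s f : s \in G -> HH f -> HH (gcomp s f).
Proof. by move=> Gs Hf; have [] := gcomp_unitary Gs Hf. Qed.

Lemma hinner_gcomp s f g : s \in G -> HH f -> HH g ->
  << gcomp s f, g >> = << f, gcomp s^-1%g g >>.
Proof.
move=> Gs Hf Hg; have [_] := gcomp_unitary Gs Hf; apply=> //.
by apply: hcarrier_gcomp; rewrite ?groupV.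
Qed.

End GroupComposition.

(** * Polynomial functions *)

Section PolynomialFunctions.
Variables (R : realType) (n : nat).
Local Notation C := (CC R).
Implicit Types (f g : 'cV[C]_n -> C) (z : 'cV[C]_n).

Definition polyfun f := exists p : mpoly.mpoly n C, f = peval p.

Lemma polyfun_cst (c : C) : polyfun (fun=> c).
Proof.
by exists (mpoly.mpolyC n c); apply/funext => z; rewrite /peval mpoly.mevalC.
Qed.

Lemma polyfun_coord i : polyfun (fun z => z i 0).
Proof.
exists (mpoly.mpolyX C (mpoly.mnm1 i)); apply/funext => z.
by rewrite /peval mpoly.mevalXU.
Qed.

Lemma polyfunD f g : polyfun f -> polyfun g -> polyfun (fun z => f z + g z).
Proof.
by move=> [p ->] [q ->]; exists (p + q); apply/funext => z; rewrite /peval mpoly.mevalD.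
Qed.

Lemma polyfunM f g : polyfun f -> polyfun g -> polyfun (fun z => f z * g z).
Proof.
by move=> [p ->] [q ->]; exists (p * q); apply/funext => z; rewrite /peval mpoly.mevalM.
Qed.

Lemma polyfunB f g : polyfun f -> polyfun g -> polyfun (fun z => f z - g z).
Proof.
by move=> [p ->] [q ->]; exists (p - q); apply/funext => z; rewrite /peval mpoly.mevalB.
Qed.

Lemma polyfun_sum (I : Type) (r : seq I) (P : pred I) (F : I -> 'cV[C]_n -> C) :
  (forall i, P i -> polyfun (F i)) -> polyfun (fun z => \sum_(i <- r | P i) F i z).
Proof.
move=> FP; elim: r => [|i r IH].
  have -> : (fun z => \sum_(i <- [::] | P i) F i z) = (fun=> 0).
    by apply/funext => z; rewrite big_nil.
  exact: polyfun_cst.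
have -> : (fun z => \sum_(j <- i :: r | P j) F j z) = (fun z =>
    (if P i then F i z else 0) + \sum_(j <- r | P j) F j z).
  by apply/funext => z; rewrite big_cons; case: ifP; rewrite ?add0r.
apply: polyfunD => //; case Pi: (P i); [exact: FP|exact: polyfun_cst].
Qed.

Lemma polyfun_prod (I : Type) (r : seq I) (P : pred I) (F : I -> 'cV[C]_n -> C) :
  (forall i, P i -> polyfun (F i)) -> polyfun (fun z => \prod_(i <- r | P i) F i z).
Proof.
move=> FP; elim: r => [|i r IH].
  have -> : (fun z => \prod_(i <- [::] | P i) F i z) = (fun=> 1).
    by apply/funext => z; rewrite big_nil.
  exact: polyfun_cst.
have -> : (fun z => \prod_(j <- i :: r | P j) F j z) = (fun z =>
    (if P i then F i z else 1) * \prod_(j <- r | P j) F j z).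
  by apply/funext => z; rewrite big_cons; case: ifP; rewrite ?mul1r.
apply: polyfunM => //; case Pi: (P i); [exact: FP|exact: polyfun_cst].
Qed.

Lemma polyfun_linear (l : 'rV[C]_n) : polyfun (fun z => (l *m z) 0 0).
Proof.
have -> : (fun z => (l *m z) 0 0) = (fun z => \sum_j l 0 j * z j 0).
  by apply/funext => z; rewrite mxE.
apply: polyfun_sum => j _.
by apply: polyfunM; [exact: polyfun_cst|exact: polyfun_coord].
Qed.

Lemma polyfun_comp f (A : 'M[C]_n) : polyfun f -> polyfun (fun z => f (A *m z)).
Proof.
move=> [p ->]; have -> : (fun z => peval p (A *m z)) = (fun z =>
    \sum_(m <- mpoly.msupp p) mpoly.mcoeff m p *
      \prod_(i < n) \prod_(k < m i) (row i A *m z) 0 0).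
  apply/funext => z; rewrite /peval mpoly.mevalE; apply: eq_bigr => m _.
  congr (_ * _); apply: eq_bigr => i _; rewrite prodr_const card_ord.
  by rewrite -row_mul [in RHS]mxE.
apply: polyfun_sum => m _; apply: polyfunM; first exact: polyfun_cst.
by do 2![apply: polyfun_prod => ? _]; exact: polyfun_linear.
Qed.

(** Lagrange interpolation in the values of L. *)
Lemma polyfun_interpolate (I : finType) (A : {pred I}) (L : 'cV[C]_n -> C)
    (x : I -> 'cV[C]_n) (c : I -> C) :
  polyfun L -> {in A &, injective (L \o x)} ->
  exists2 q, polyfun q & forall i, i \in A -> q (x i) = c i.
Proof.
move=> PL linj; pose q z := \sum_(i in A) c i *
  \prod_(j in A | j != i) ((L z - L (x j)) * (L (x i) - L (x j))^-1).
exists q.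
  apply: polyfun_sum => i _; apply: polyfunM; first exact: polyfun_cst.
  apply: polyfun_prod => j _; apply: polyfunM; last exact: polyfun_cst.
  by apply: polyfunB => //; exact: polyfun_cst.
move=> i Ai; rewrite /q (bigD1 i) //= [X in _ + X]big1 ?addr0.
  rewrite big1 ?mulr1 // => j /andP[Aj ji]; rewrite divff // subr_eq0.
  by apply: contra_neq ji => e; apply/esym/linj.
move=> k /andP[Ak ki]; rewrite (bigD1 i) /=; last by rewrite Ai eq_sym.
by rewrite subrr !mul0r mulr0.
Qed.

End PolynomialFunctions.

(** * Points with a free orbit *)

Section GeneralPosition.
Variables (R : realType).
Local Notation C := (CC R).

Lemma polys_common_nonroot (I : finType) (P : pred I) (p : I -> {poly C}) (e : C) :
  0 < e -> (forall i, P i -> p i != 0) ->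
  exists2 t : C, 0 < t < e & forall i, P i -> (p i).[t] != 0.
Proof.
move=> e0 p0; pose q := \prod_(i | P i) p i.
have q0 : q != 0 by apply/prodf_neq0.
have [N NP] := invS_small e0.
pose rs : seq C := [seq (N + k).+1%:R^-1 | k <- iota 0 (size q)].
have urs : uniq rs.
  rewrite map_inj_uniq ?iota_uniq // => j k /invr_inj/eqP.
  by rewrite eqr_nat eqSS eqn_add2l => /eqP.
have /allPn[t trs qt] : ~~ all (root q) rs.
  apply/negP => qrs; have := max_poly_roots q0 qrs urs.
  by rewrite size_map size_iota ltnn.
exists t => [|i Pi].
  move/mapP: trs => [k _ ->]; rewrite invr_gt0 ltr0n NP //; exact: leq_addr.
apply: contra qt => pt; rewrite /q (bigD1 i) //= rootM; apply/orP; left.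
exact: pt.
Qed.

(** A row (1, t, t^2, ...) on the moment curve works for all but finitely many t. *)
Lemma separating_row (n m : nat) (I : finType) (P : pred I) (A : I -> 'M[C]_(n, m)) :
  (forall i, P i -> A i != 0) ->
  exists l : 'rV[C]_n, forall i, P i -> l *m A i != 0.
Proof.
move=> A0.
have kP i : exists k : option 'I_m, P i -> exists2 j, k = Some j & col j (A i) != 0.
  have [Pi|nPi] := boolP (P i); last by exists None.
  have /eqP/matrixP := A0 i Pi => A0'.
  have [j Aj] : exists j, col j (A i) != 0.
    apply: contra_notP A0' => /forallNP col0 k j.
    have /negP/negPn/eqP/matrixP/(_ k 0) := col0 j.
    by rewrite !mxE.
  by exists (Some j) => _; exists j.
have [k {}kP] := choice kP.
pose p i := if k i is Some j then rVpoly (col j (A i))^T else 0.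
have [|t _ tP] := @polys_common_nonroot I P p 1 ltr01.
  move=> i Pi; have [j kj Aj] := kP i Pi; rewrite /p kj.
  by apply: contra_neq Aj => e; apply: trmx_inj; rewrite -[LHS]rVpolyK e !linear0.
exists (\row_j t ^+ j) => i Pi; have [j kj Aj] := kP i Pi.
have := tP i Pi; apply: contra_neq => /matrixP/(_ 0 j); rewrite mxE [RHS]mxE => e.
rewrite /p kj horner_poly -[RHS]e; apply: eq_bigr => a _.
by rewrite valK !mxE mulrC.
Qed.

(** Starting from a point of Omega in a direction on which no a i vanishes, each
   a i vanishes for at most one step length. *)
Lemma open_general_point (n : nat) (I : finType) (P : pred I)
    (a : I -> 'rV[C]_n) (Omega : set 'cV[C]_n) :
  open Omega -> Omega !=set0 -> (forall i, P i -> a i != 0) ->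
  exists2 w, Omega w & forall i, P i -> a i *m w != 0.
Proof.
move=> oO [z0 Oz0] a0.
have [|l lP] := @separating_row n 1 I P (fun i => (a i)^T).
  by move=> i /a0; apply: contra_neq => e; apply: trmx_inj; rewrite e trmx0.
pose u := l^T.
have au i : P i -> (a i *m u) 0 0 != 0.
  move=> /lP; apply: contra_neq => e; apply/matrixP => x y; rewrite !ord1.
  by rewrite -[l]trmxK -trmx_mul mxE e mxE.
have /nbhs_ballP[e /= e0 eO] : nbhs z0 Omega by exact: open_nbhs_nbhs.
pose M := 1 + \sum_j `|u j 0|.
have M0 : 0 < M by rewrite ltr_pwDl ?ltr01 // sumr_ge0.
pose p i : {poly C} := ((a i *m u) 0 0)%:P * 'X + ((a i *m z0) 0 0)%:P.
have [|t /andP[t0 te] tP] := @polys_common_nonroot I P p _ (divr_gt0 e0 M0).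
  move=> i /au; apply: contra_neq => /(congr1 (fun q : {poly C} => q`_1)).
  by rewrite coefD coefMX !coefC /= addr0.
exists (z0 + t *: u).
  apply: eO; split=> // i j.
  rewrite ord1 !mxE /ball /= opprD addNKr normrN normrM gtr0_norm //.
  rewrite ltr_pdivlMr // in te; apply: le_lt_trans te.
  apply: ler_wpM2l; first exact: ltW.
  rewrite /M (bigD1 i) //= mxE addrCA lerDl addr_ge0 ?ler01 //.
  exact: sumr_ge0.
move=> i Pi; have := tP i Pi; rewrite /p !hornerE; apply: contra_neq.
rewrite mulmxDr -scalemxAr => /matrixP/(_ 0 0); rewrite !mxE => e'.
by rewrite addrC mulrC.
Qed.

End GeneralPosition.

(** * Matrix coefficient operators *)

Section GroupSums.
Variables (V : nmodType) (gT : finGroupType) (G : {group gT}).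
Implicit Types (F : gT -> V) (s : gT).

Lemma group_sum_mulr F s : s \in G ->
  \sum_(t in G) F t = \sum_(t in G) F (t * s)%g.
Proof.
move=> Gs; rewrite (reindex_inj (mulIg s)); apply: eq_bigl => t.
by rewrite groupMr.
Qed.

Lemma group_sum_mull F s : s \in G ->
  \sum_(t in G) F t = \sum_(t in G) F (s * t)%g.
Proof.
move=> Gs; rewrite (reindex_inj (mulgI s)); apply: eq_bigl => t.
by rewrite groupMl.
Qed.

Lemma group_sum_inv F : \sum_(t in G) F t = \sum_(t in G) F t^-1%g.
Proof.
by rewrite (reindex_inj invg_inj); apply: eq_bigl => t; rewrite groupV.
Qed.

End GroupSums.

Section SchurOrthogonality.
Variables (R : realType) (gT : finGroupType) (G : {group gT}).
Variable rho : unitary_irrep R G.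
Local Notation C := (CC R).
Local Notation d := (irr_deg rho).

Lemma irr_deg_gt0 : (0 < d)%N.
Proof. by case: (mx_irrP rho) => /(_ (irr_irreducible rho))[]. Qed.

Lemma irr_deg_neq0 : d%:R != 0 :> C.
Proof. by rewrite pnatr_eq0 -lt0n irr_deg_gt0. Qed.

Lemma card_group_neq0 : #|G|%:R != 0 :> C.
Proof. by rewrite pnatr_eq0 -lt0n cardG_gt0. Qed.

Lemma irr_mxV s i j : s \in G -> rho s^-1%g i j = Num.conj (rho s j i).
Proof.
move=> Gs; have /unitarymxP us := irr_unitary rho Gs.
have -> : rho s^-1%g = map_mx Num.conj (rho s)^T.
  rewrite -[RHS]mul1mx -(repr_mx1 rho) -(mulVg s) repr_mxM ?groupV //.
  by rewrite -mulmxA us mulmx1.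
by rewrite !mxE.
Qed.

(** Schur's lemma over an algebraically closed field: subtracting an eigenvalue
   leaves a noninvertible, hence zero, intertwiner. *)
Lemma irr_cent_scalar (Y : 'M[C]_d) :
  (forall t, t \in G -> Y *m rho t = rho t *m Y) -> exists a, Y = a%:M.
Proof.
move=> cY; have [a ev] := eigenvalue_closed Y irr_deg_gt0.
exists a; apply/subr0_eq; apply: contraTeq ev => Ya0.
have : Y - a%:M \in unitmx.
  apply: (mx_Schur (irr_irreducible rho)) Ya0; apply/centgmxP => t Gt.
  by rewrite mulmxBl mulmxBr cY // scalar_mxC.
rewrite -row_free_unit => fr; apply/negP => /eigenvalueP[v vY v0].
case/negP: v0; rewrite -(mulmx_free_eq0 v fr) mulmxBr vY mul_mx_scalar subrr.
exact: eqxx.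
Qed.

(** Averaging the conjugates of a matrix unit gives a scalar matrix by Schur's
   lemma, and the scalar is read off from the trace. *)
Lemma schur_orthogonality i j k l :
  \sum_(s in G) rho s^-1%g i j * rho s k l =
  (#|G|%:R / d%:R) *+ ((i == l) && (j == k)) :> C.
Proof.
pose Y := \sum_(s in G) rho s^-1%g *m delta_mx j k *m rho s.
have YE a b : Y a b = \sum_(s in G) rho s^-1%g a j * rho s k b.
  rewrite /Y summxE; apply: eq_bigr => s _.
  by rewrite -(mul_delta_mx (0 : 'I_1)) mulmxA -colE -mulmxA -rowE mxE big_ord1 !mxE.
have [t Gt|a Ya] := @irr_cent_scalar Y.
  have tV : rho t *m rho t^-1%g = 1%:M.
    by rewrite -repr_mxM ?groupV // mulgV repr_mx1.
  rewrite /Y mulmx_suml mulmx_sumr [RHS](group_sum_mulr _ Gt).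
  apply: eq_bigr => s Gs; rewrite invMg !repr_mxM ?groupV // !mulmxA.
  by rewrite tV mul1mx.
rewrite -YE Ya mxE; have [_|_] := eqVneq i l; last by rewrite !mulr0n.
rewrite /=.
have trY : \tr Y = #|G|%:R *+ (j == k).
  rewrite /Y raddf_sum /= (eq_bigr (fun=> (j == k)%:R)) => [|s Gs].
    by rewrite sumr_const -mulrnA mulnC mulrnA.
  have sV : rho s *m rho s^-1%g = 1%:M.
    by rewrite -repr_mxM ?groupV // mulgV repr_mx1.
  rewrite mxtrace_mulC mulmxA sV mul1mx.
  rewrite /mxtrace (bigD1 j) //= big1 ?addr0 => [|b bj]; first by rewrite mxE eqxx.
  by rewrite mxE (negPf bj).
move: trY; rewrite Ya mxtrace_scalar => e; rewrite mulr1n.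
apply: (mulIf irr_deg_neq0); rewrite mulr_natr e.
by case: (j == k); rewrite ?mulr0n ?mul0r // !mulr1n mulfVK ?irr_deg_neq0.
Qed.

End SchurOrthogonality.

Section CoefficientOperators.
Variables (R : realType) (n : nat) (gT : finGroupType) (G : {group gT}).
Variables (rG : mx_representation (CC R) G n) (rho : unitary_irrep R G).
Local Notation C := (CC R).
Local Notation d := (irr_deg rho).
Implicit Types (f g h : 'cV[C]_n -> C) (i j k l : 'I_d).

(** For i = j this is the projection P^ii; for i <> j it is a partial isometry
   between the ranges of two such projections. *)
Definition coef_op i j f : 'cV[C]_n -> C := fun z =>
  d%:R / #|G|%:R * \sum_(s in G) rho (s^-1)%g i j * f (rG (s^-1)%g *m z).

Lemma coef_opE i j f : coef_op i j f =
  (fun z => \sum_(s in G) (d%:R / #|G|%:R * rho (s^-1)%g i j) * gcomp rG s^-1%g f z).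
Proof.
by apply/funext => z; rewrite /coef_op mulr_sumr; apply: eq_bigr => s _; rewrite mulrA.
Qed.

Lemma coef_op_lin i j a f g :
  coef_op i j (a \*o f \+ g) = a \*o coef_op i j f \+ coef_op i j g.
Proof.
apply/funext => z; rewrite /coef_op /= mulrCA -mulrDr; congr (_ * _).
by rewrite mulr_sumr -big_split; apply: eq_bigr => s _ /=; ring.
Qed.

Lemma coef_op_sum (I : Type) (r : seq I) (P : pred I) i j (c : I -> C)
    (F : I -> 'cV[C]_n -> C) :
  coef_op i j (fun z => \sum_(a <- r | P a) c a * F a z) =
  (fun z => \sum_(a <- r | P a) c a * coef_op i j (F a) z).
Proof.
apply/funext => z; rewrite /coef_op.
under [RHS]eq_bigr do rewrite mulrCA mulr_sumr.
rewrite -mulr_sumr exchange_big /=; congr (_ * _); apply: eq_bigr => s _.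
by rewrite mulr_sumr; apply: eq_bigr => a _; rewrite mulrCA.
Qed.

Lemma coef_op_invariant i j (p : mpoly.mpoly n C) f : invariant_poly rG p ->
  coef_op i j (peval p \* f) = peval p \* coef_op i j f.
Proof.
move=> ip; apply/funext => z; rewrite /coef_op /= [RHS]mulrCA; congr (_ * _).
by rewrite mulr_sumr; apply: eq_bigr => s Gs; rewrite ip ?groupV // mulrCA.
Qed.

Lemma coef_op_gcomp i j s f : s \in G ->
  coef_op i j (gcomp rG s^-1%g f) = (fun z => \sum_k rho s i k * coef_op k j f z).
Proof.
move=> Gs; apply/funext => z; rewrite /coef_op.
under [RHS]eq_bigr do rewrite mulrCA mulr_sumr.
rewrite -mulr_sumr exchange_big /=; congr (_ * _).
rewrite (group_sum_mulr _ (groupVr Gs)); apply: eq_bigr => t Gt.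
rewrite /gcomp -gactM ?groupV ?groupM ?groupV // invMg invgK mulgA mulVg mul1g.
rewrite repr_mxM ?groupV // mxE mulr_suml.
by apply: eq_bigr => k _; rewrite mulrA.
Qed.

Lemma gcomp_coef_op i j s f : s \in G ->
  gcomp rG s^-1%g (coef_op i j f) = (fun z => \sum_k rho s k j * coef_op i k f z).
Proof.
move=> Gs; apply/funext => z; rewrite /gcomp /coef_op.
under [RHS]eq_bigr do rewrite mulrCA mulr_sumr.
rewrite -mulr_sumr exchange_big /=; congr (_ * _).
rewrite (group_sum_mull _ (groupVr Gs)); apply: eq_bigr => t Gt.
rewrite -gactM ?groupV ?groupM ?groupV // invMg invgK -mulgA mulgV mulg1.
rewrite repr_mxM ?groupV // mxE mulr_suml.
by apply: eq_bigr => k _; rewrite mulrCA mulrA.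
Qed.

(** By Schur orthogonality the coefficient operators multiply like matrix units,
   up to the order of the factors. *)
Lemma coef_op_mul i j k l f :
  coef_op i j (coef_op k l f) = (fun z => coef_op k j f z *+ (i == l)).
Proof.
rewrite [coef_op i j _]coef_opE; apply/funext => z.
have eqs s : s \in G ->
    d%:R / #|G|%:R * rho s^-1%g i j * gcomp rG s^-1%g (coef_op k l f) z =
    \sum_m (d%:R / #|G|%:R * coef_op k m f z) * (rho s^-1%g i j * rho s m l).
  move=> Gs; rewrite gcomp_coef_op // mulr_sumr; apply: eq_bigr => m _; ring.
rewrite (eq_bigr _ eqs) exchange_big /=.
under eq_bigr do rewrite -mulr_sumr schur_orthogonality.
have [_|_] := eqVneq i l; last by rewrite big1 ?mulr0n // => m _; rewrite mulr0.
rewrite (bigD1 j) //= big1 ?addr0 => [|m mj].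
  rewrite eqxx !mulr1n; field.
  by rewrite irr_deg_neq0 card_group_neq0.
by rewrite eq_sym (negPf mj) mulr0.
Qed.

Variables (Omega : set 'cV[C]_n) (H : hilbert_fun_space Omega).
Variable (K : 'cV[C]_n -> 'cV[C]_n -> C).
Hypothesis hinv : invariant_domain rG Omega.
Hypothesis hrep : reproducing_kernel H K.
Hypothesis hK : invariant_kernel rG Omega K.

Lemma hcarrier_coef_op i j f : hcarrier H f -> hcarrier H (coef_op i j f).
Proof.
move=> Hf; rewrite coef_opE; apply: hcarrier_sum => s Gs.
by apply: (hcarrier_gcomp hinv hrep hK) => //; rewrite groupV.
Qed.

Lemma coef_op_adjoint i j f g : hcarrier H f -> hcarrier H g ->
  hinner H (coef_op i j f) g = hinner H f (coef_op j i g).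
Proof.
move=> Hf Hg; have Hs h s : hcarrier H h -> s \in G -> hcarrier H (gcomp rG s^-1%g h).
  by move=> Hh Gs; apply: (hcarrier_gcomp hinv hrep hK) => //; rewrite groupV.
rewrite !coef_opE hinner_suml // => [|s Gs]; last exact: Hs.
rewrite hinner_sumr // => [|s Gs]; last exact: Hs.
rewrite [RHS]group_sum_inv; apply: eq_bigr => s Gs.
rewrite (hinner_gcomp hinv hrep hK) ?groupV // invgK; congr (_ * _).
rewrite !rmorphM /= fmorphV /= !rmorph_nat; congr (_ * _).
by rewrite irr_mxV.
Qed.

End CoefficientOperators.

(** * Dimension of a space of functions *)

Section FreeFamilies.
Variables (K : fieldType) (X : Type).
Implicit Types (I J : finType).

Definition lincomb I (c : I -> K) (e : I -> X -> K) : X -> K :=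
  fun z => \sum_i c i * e i z.

Definition free_family I (e : I -> X -> K) :=
  forall c, lincomb c e = (fun=> 0) -> forall i, c i = 0.

Definition basis_family (S : set (X -> K)) I (e : I -> X -> K) :=
  [/\ free_family e, forall i, S (e i) & forall f, S f -> exists c, f = lincomb c e].

(** Steinitz: in matrix form, the coordinate matrix of e has free rows. *)
Lemma free_family_card I J (e : I -> X -> K) (g : J -> X -> K) :
  free_family e -> (forall i, exists c, e i = lincomb c g) -> (#|I| <= #|J|)%N.
Proof.
move=> fe /choice[A eA].
pose M := \matrix_(i < #|I|, j < #|J|) A (enum_val i) (enum_val j).
suff : row_free M by move/eqP <-; exact: rank_leq_col.
apply: inj_row_free => v vM0; apply/rowP => i.
have -> : v 0 i = v 0 (enum_rank (enum_val i)) by rewrite enum_valK.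
rewrite [RHS]mxE; apply: (fe (fun a => v 0 (enum_rank a))).
apply/funext => z; rewrite /lincomb.
under eq_bigr => a _ do rewrite eA /lincomb mulr_sumr.
rewrite exchange_big big1 //= => j _.
under eq_bigr do rewrite mulrA.
rewrite -mulr_suml (reindex (@enum_val I I)) /=; last exact/onW_bij/enum_val_bij.
have /rowP/(_ (enum_rank j)) := vM0; rewrite !mxE => vj.
rewrite [X in X * _](_ : _ = 0) ?mul0r //; rewrite -[RHS]vj.
by apply: eq_bigr => a _; rewrite !mxE enum_valK enum_rankK.
Qed.

End FreeFamilies.

(** * Joint eigenspaces of the adjoints of invariant multiplications *)

Section JointEigenspace.
Variables (R : realType) (n : nat) (gT : finGroupType) (G : {group gT}).
Variables (rG : mx_representation (CC R) G n).
Variables (Omega : set 'cV[CC R]_n) (H : hilbert_fun_space Omega).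
Local Notation C := (CC R).
Implicit Types (M N : set ('cV[C]_n -> C)) (w : 'cV[C]_n).

(** The weak form of M_p^* f = conj (p w) f, with M_p the multiplication by p. *)
Definition joint_eigenspace M w : set ('cV[C]_n -> C) := fun f =>
  M f /\ forall p g, invariant_poly rG p -> M g ->
    hinner H (peval p \* g) f = peval p w * hinner H g f.

Definition invariant_submodule M :=
  [/\ M `<=` hcarrier H, M (fun=> 0),
      forall a f g, M f -> M g -> M (a \*o f \+ g) &
      forall p f, invariant_poly rG p -> M f -> M (peval p \* f)].

Lemma submodule_lincomb M (I : finType) (c : I -> C) (e : I -> 'cV[C]_n -> C) :
  invariant_submodule M -> (forall i, M (e i)) -> M (lincomb c e).
Proof.
move=> [_ M0 Mlin _] Me; rewrite /lincomb; elim: (index_enum I) => [|i r IH].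
  by move: M0; congr M; apply/funext => z; rewrite big_nil.
have := Mlin (c i) _ _ (Me i) IH.
by congr M; apply/funext => z; rewrite big_cons.
Qed.

Lemma linear_lincomb M U (I : finType) (c : I -> C) (e : I -> 'cV[C]_n -> C) :
  invariant_submodule M ->
  (forall a f g, M f -> M g -> U (a \*o f \+ g) = a \*o U f \+ U g) ->
  (forall i, M (e i)) -> U (lincomb c e) = lincomb c (U \o e) :> ('cV[C]_n -> C).
Proof.
move=> [_ M0 Mlin _] Ulin Me; rewrite /lincomb.
elim: (index_enum I) => [|i r IH].
  have := Ulin 1 _ _ M0 M0; set f := (X in U X = _ -> _).
  have -> : f = (fun=> 0) by apply/funext => z; rewrite /f /= mulr0 addr0.
  move=> U0; have {}U0 : U (fun=> 0) = (fun=> 0).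
    apply/funext => z; have := congr1 (@^~ z) U0.
      move=> /= /eqP; rewrite mul1r -[X in X == _]addr0 (inj_eq (addrI _)) eq_sym.
    by move/eqP.
  transitivity (U (fun=> 0)); last by rewrite U0; apply/funext => z; rewrite big_nil.
  by congr U; apply/funext => z; rewrite big_nil.
have Mr : M (fun z => \sum_(j <- r) c j * e j z).
  elim: {IH} r => [|j r IH].
    by move: M0; congr M; apply/funext => z; rewrite big_nil.
  have := Mlin (c j) _ _ (Me j) IH.
  by congr M; apply/funext => z; rewrite big_cons.
transitivity (U (c i \*o e i \+ (fun z => \sum_(j <- r) c j * e j z))).
  by congr U; apply/funext => z; rewrite big_cons.
by rewrite Ulin // IH; apply/funext => z; rewrite /= big_cons.
Qed.

(** A unitary module map restricts to a bijection of joint eigenspaces, so the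
   dimension of the joint eigenspace is an invariant of the submodule. *)
Lemma equivalent_eigenspace_card M N w (I J : finType) e e' :
  invariant_submodule M -> invariant_submodule N ->
  unitarily_equivalent rG H M N ->
  basis_family (joint_eigenspace M w) (e : I -> _) ->
  basis_family (joint_eigenspace N w) (e' : J -> _) -> #|I| = #|J|.
Proof.
move=> sM sN [U [UMN Ulin Uiso Upoly]] [fe Me span_e] [fe' Me' span_e'].
have [MH M0 Mlin Mp] := sM; have [NH N0 Nlin Np] := sN.
have UN f : M f -> N (U f) by move=> Mf; rewrite -UMN; exists f.
have Mei i : M (e i) by case: (Me i).
have Ucomb c : U (lincomb c e) = lincomb c (U \o e) by exact: linear_lincomb sM Ulin Mei.
apply/eqP; rewrite eqn_leq; apply/andP; split.
  apply: (@free_family_card _ _ I J (U \o e) e') => [c c0 i|i].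
    apply: fe; rewrite -Ucomb in c0.
    have Mc : M (lincomb c e) by exact: submodule_lincomb.
    apply: (hinner_def (MH _ Mc)).
    by rewrite -Uiso // c0 hinner0l //; exact: hzero.
  apply: span_e'; split; first exact: UN.
  move=> p g ip; rewrite -UMN => -[g' Mg' <-].
  rewrite -Upoly // !Uiso //; last exact: Mp.
  by case: (Me i) => _; apply.
apply: (@free_family_card _ _ J I e' (U \o e)) => // j.
have [] := Me' j; rewrite -{1}UMN => -[f Mf <-] Vf.
have [|c fc] := span_e f; last by exists c; rewrite fc Ucomb.
split=> // p g ip Mg; have := Vf p (U g) ip (UN _ Mg).
by rewrite -Upoly // !Uiso //; exact: Mp.
Qed.

End JointEigenspace.

(** * The joint eigenspace at a point with a free orbit *)

Section FreeOrbit.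
Variables (R : realType) (n : nat) (gT : finGroupType) (G : {group gT}).
Variables (rG : mx_representation (CC R) G n).
Variables (Omega : set 'cV[CC R]_n) (H : hilbert_fun_space Omega).
Variable (K : 'cV[CC R]_n -> 'cV[CC R]_n -> CC R).
Local Notation C := (CC R).
Local Notation HH := (hcarrier H).
Local Notation "<< f , g >>" := (hinner H f g).
Implicit Types (f g h q : 'cV[C]_n -> C) (s t : gT) (z w : 'cV[C]_n).

Hypothesis hinv : invariant_domain rG Omega.
Hypothesis hH : analytic_hilbert_module H K.
Hypothesis hK : invariant_kernel rG Omega K.

Lemma module_kernel : reproducing_kernel H K.
Proof. by case: hH. Qed.

Lemma hcarrier_poly q : polyfun q -> HH (q \_ Omega).
Proof. by case: hH => _ _ _ Hp _ [p ->]; exact: Hp. Qed.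

Lemma hcarrier_mul p f : HH f -> HH (peval p \* f).
Proof. by case: hH => _ _ Hm _ _ Hf; have [c /(_ _ Hf)[]] := Hm p. Qed.

Lemma restrictE f z : Omega z -> (f \_ Omega) z = f z.
Proof. by move=> Oz; rewrite patchE mem_set. Qed.

(** The polynomials are dense, and pairing with h is continuous. *)
Lemma ortho_poly_eq0 h : HH h ->
  (forall q, polyfun q -> << q \_ Omega, h >> = 0) -> h = (fun=> 0).
Proof.
move=> Hh hq; apply: (hinner_def Hh); apply: eq0_of_small => e e0.
have N0 : 0 < ip_norm (hinner H) h + 1 by rewrite ltr_wpDl ?ip_norm_ge0.
have [_ _ _ _ dense] := hH; have [p pP] := dense h Hh _ (divr_gt0 e0 N0).
have Hp : HH (peval p \_ Omega) by apply: hcarrier_poly; exists p.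
have HB := hcarrierB Hh Hp.
have -> : << h, h >> = << h \- (peval p \_ Omega), h >>.
  by rewrite hinnerBl // hq ?subr0 //; exists p.
apply: le_lt_trans (norm_hinner_le HB Hh) _.
rewrite ltr_pdivlMr // in pP; apply: le_lt_trans pP.
by rewrite ler_wpM2l ?lerDl ?ler01 ?ip_norm_ge0.
Qed.

Variables (w : 'cV[C]_n) (L : 'cV[C]_n -> C).
Hypothesis Ow : Omega w.
Hypothesis polyL : polyfun L.
Hypothesis linj : {in G &, injective (fun s => L (rG s *m w))}.

Section Functional.
Variable f : 'cV[C]_n -> C.
Hypothesis Vf : joint_eigenspace rG H HH w f.
Let Hf : HH f. Proof. by case: Vf. Qed.
Local Notation ip q := << q \_ Omega, f >>.

Lemma ip_polyB q h : polyfun q -> polyfun h ->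
  ip (fun z => q z - h z) = ip q - ip h.
Proof.
move=> Pq Ph; have Hq := hcarrier_poly Pq; have Hh := hcarrier_poly Ph.
rewrite -hinnerBl //; congr hinner.
apply: (hcarrier_eqP (hcarrier_poly (polyfunB Pq Ph)) (hcarrierB Hq Hh)) => z Oz.
by rewrite /= !restrictE.
Qed.

Lemma ip_invariant q h : polyfun q -> polyfun h ->
  (forall s z, s \in G -> q (rG s *m z) = q z) ->
  ip (fun z => q z * h z) = q w * ip h.
Proof.
move=> [p ->] Ph ip; have Hh := hcarrier_poly Ph.
rewrite -(Vf.2 p) //; congr hinner.
apply: (hcarrier_eqP _ (hcarrier_mul p Hh)) => [|z Oz].
  by apply: hcarrier_poly; apply: polyfunM => //; exists p.
by rewrite /= !restrictE.
Qed.

(** Induction on r: the two halves of the factor at t replace q by q * L, or h by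
   h times the translate of L by t, and both keep the hypotheses. For empty r the
   sum is the orbit sum of q, which is invariant and vanishes at w. *)
Lemma ip_orbit_product (r : seq gT) q h : polyfun q -> polyfun h ->
  (forall s, s \in G -> q (rG s *m w) = 0) ->
  ip (fun z => (\sum_(s in G) q (rG s *m z) *
        \prod_(t <- r) (L (rG s *m z) - L (rG t *m z))) * h z) = 0.
Proof.
have PL A : polyfun (fun z => L (A *m z)).
  exact: polyfun_comp.
elim: r q h => [|t r IH] q h Pq Ph q0.
  have := @ip_invariant (fun z => \sum_(s in G) q (rG s *m z)) h.
  rewrite big1 ?mul0r => [ipq|]; last exact: q0.
  rewrite -[RHS]ipq //.
  - congr (hinner H (_ \_ Omega) f); apply/funext => z; congr (_ * _).
    by apply: eq_bigr => s _; rewrite big_nil mulr1.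
  - by apply: polyfun_sum => s _; exact: polyfun_comp.
  - move=> s z Gs; rewrite /= [RHS](group_sum_mulr _ Gs) /=.
    by apply: eq_bigr => t Gt; rewrite gactM.
pose S q z := \sum_(s in G) q (rG s *m z) *
  \prod_(t <- r) (L (rG s *m z) - L (rG t *m z)).
have PS q' : polyfun q' -> polyfun (S q').
  move=> Pq'; apply: polyfun_sum => s _; apply: polyfunM; first exact: polyfun_comp.
  by apply: polyfun_prod => a _; exact: polyfunB.
pose qL z := q z * L z; pose hL z := L (rG t *m z) * h z.
have PqL : polyfun qL by exact: polyfunM.
have PhL : polyfun hL by exact: polyfunM.
have := ip_polyB (polyfunM (PS _ PqL) Ph) (polyfunM (PS _ Pq) PhL).
rewrite (IH qL h) // => [|s Gs]; last by rewrite /qL q0 // mul0r.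
rewrite (IH q hL) // subr0 => e; rewrite -[RHS]e; congr (hinner H (_ \_ Omega) f).
apply/funext => z.
have -> : \sum_(s in G) q (rG s *m z) *
    \prod_(a <- t :: r) (L (rG s *m z) - L (rG a *m z)) =
    S qL z - S q z * L (rG t *m z).
  rewrite /S mulr_suml -sumrB; apply: eq_bigr => s _.
  by rewrite big_cons /qL; ring.
by rewrite /hL; move: (S qL z) (S q z) => a b; ring.
Qed.

(** With all t <> 1 in the product, the sum collapses to its term at 1, so q
   times an invariant polynomial not vanishing at w is orthogonal to f. *)
Lemma ip_vanish_orbit q : polyfun q ->
  (forall s, s \in G -> q (rG s *m w) = 0) -> ip q = 0.
Proof.
move=> Pq q0; pose r := enum (G :\ 1%g).
have PL A : polyfun (fun z => L (A *m z)).
  exact: polyfun_comp.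
pose d z := \prod_(t <- r) (L z - L (rG t *m z)).
have Pd : polyfun d.
  by apply: polyfun_prod => t _; exact: polyfunB.
pose h z := \prod_(s in G :\ 1%g) d (rG s *m z).
have Ph : polyfun h by apply: polyfun_prod => s _; exact: polyfun_comp.
pose D z := \prod_(s in G) d (rG s *m z).
have PD : polyfun D by apply: polyfun_prod => s _; exact: polyfun_comp.
have Dw : D w != 0.
  apply/prodf_neq0 => s Gs; rewrite /d prodf_seq_neq0; apply/allP => t /=.
  rewrite mem_enum !inE => /andP[t1 Gt]; rewrite subr_eq0 -gactM //.
  apply: contra_neq t1 => /linj e; have {}e : s = (t * s)%g.
    by apply: e; rewrite ?groupM.
  by apply: (mulIg s); rewrite mul1g -e.
have := ip_orbit_product r Pq Ph q0.
have -> : (fun z => (\sum_(s in G) q (rG s *m z) *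
    \prod_(t <- r) (L (rG s *m z) - L (rG t *m z))) * h z) = (fun z => D z * q z).
  apply/funext => z; rewrite (big_setD1 1%g) //= gact1 [X in _ + X]big1 ?addr0.
    rewrite -/(d z) /D (big_setD1 1%g) //= gact1 -/(h z); ring.
  move=> s Gs; rewrite (bigD1_seq s) ?enum_uniq ?mem_enum //=.
  by apply/eqP; rewrite !mulf_eq0 subr_eq0 eqxx orbT.
have Dinv s z : s \in G -> D (rG s *m z) = D z; last first.
  by rewrite (ip_invariant PD Pq Dinv) => /eqP; rewrite mulf_eq0 (negPf Dw) => /eqP.
move=> Gs; rewrite /D [RHS](reindex_inj (mulIg s)) /=; apply: eq_big => t.
  by rewrite groupMr.
by move=> Gt; rewrite gactM.
Qed.

End Functional.

Lemma orbit_interpolate (c : gT -> C) :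
  exists2 q, polyfun q & forall s, s \in G -> q (rG s *m w) = c s.
Proof. exact: polyfun_interpolate polyL linj. Qed.

(** By ip_vanish_orbit, f pairs with p as with the interpolation p' of p on the
   orbit of w, and this determines the coefficients of f. *)
Lemma eigenspace_kernel_span f : joint_eigenspace rG H HH w f ->
  exists c : gT -> C, f = (fun z => \sum_(s in G) c s * K z (rG s *m w)).
Proof.
move=> Vf; have Hf := Vf.1.
have /choice[q qP] : forall s, exists q, polyfun q /\
    forall t, t \in G -> q (rG t *m w) = (t == s)%:R.
  by move=> s; have [q] := orbit_interpolate (fun t => (t == s)%:R); exists q.
have Pq s : polyfun (q s) by case: (qP s).
have qE s t : t \in G -> q s (rG t *m w) = (t == s)%:R by case: (qP s) => _; apply.
have Hq s := hcarrier_poly (Pq s).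
have Osw s : s \in G -> Omega (rG s *m w) by move=> Gs; apply/(domain_act hinv).
have HK s : s \in G -> HH (K^~ (rG s *m w)).
  by move=> Gs; apply: (hcarrier_kernel module_kernel); exact: Osw.
exists (fun s => << f, q s \_ Omega >>); set g := (X in _ = X).
have Hg : HH g by exact: hcarrier_sum.
suff : f \- g = (fun=> 0).
  by move=> fg; apply/funext => z; apply/subr0_eq; have := congr1 (@^~ z) fg.
apply: (ortho_poly_eq0 (hcarrierB Hf Hg)) => p Pp; have Hp := hcarrier_poly Pp.
rewrite hinnerBr // hinner_sumr //.
pose p' z := \sum_(s in G) p (rG s *m w) * q s z.
have Pp' : polyfun p'.
  by apply: polyfun_sum => s _; apply: polyfunM => //; exact: polyfun_cst.
have Hp' := hcarrier_poly Pp'.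
have -> : << p \_ Omega, f >> = << p' \_ Omega, f >>.
  apply/subr0_eq; rewrite -ip_polyB //.
  apply: ip_vanish_orbit => // [|s Gs]; first exact: polyfunB.
  rewrite /p' (bigD1 s) //= qE // eqxx mulr1 big1 ?addr0 ?subrr // => t /andP[Gt ts].
  by rewrite qE // eq_sym (negPf ts) mulr0.
have -> : p' \_ Omega = (fun z => \sum_(s in G) p (rG s *m w) * (q s \_ Omega) z).
  apply: (hcarrier_eqP Hp'); first exact: hcarrier_sum.
  by move=> z Oz; rewrite restrictE //; apply: eq_bigr => s _; rewrite restrictE.
rewrite hinner_suml // -sumrB big1 // => s Gs.
rewrite (hinner_kernel module_kernel (Osw s Gs) Hp) (restrictE _ (Osw s Gs)).
by rewrite -(hinner_conj Hf (Hq s)) mulrC subrr.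
Qed.

End FreeOrbit.

(** * Ranges of sums of diagonal coefficient operators *)

Section BlockProjection.
Variables (R : realType) (n : nat) (gT : finGroupType) (G : {group gT}).
Variables (rG : mx_representation (CC R) G n) (rho : unitary_irrep R G).
Variables (Omega : set 'cV[CC R]_n) (H : hilbert_fun_space Omega).
Variable (K : 'cV[CC R]_n -> 'cV[CC R]_n -> CC R).
Local Notation C := (CC R).
Local Notation d := (irr_deg rho).
Local Notation HH := (hcarrier H).
Local Notation "<< f , g >>" := (hinner H f g).
Local Notation T := (coef_op rG).
Implicit Types (f g h q : 'cV[C]_n -> C) (J : {set 'I_d}).

(** A common form of both families of projections: J is a singleton for P^ii
   and everything for the isotypic projection. *)
Definition block_proj J f : 'cV[C]_n -> C := fun z => \sum_(i in J) T i i f z.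

Lemma block_proj1 i : block_proj [set i] = diag_proj rG i.
Proof. by apply/funext => f; apply/funext => z; rewrite /block_proj big_set1. Qed.

Lemma block_projT : block_proj [set: 'I_d] = isotypic_proj rG rho.
Proof.
apply/funext => f; apply/funext => z; rewrite /block_proj /isotypic_proj.
rewrite -mulr_sumr exchange_big /=; congr (_ * _); apply: eq_bigr => s _.
by rewrite -mulr_suml /irr_char /mxtrace; congr (_ * _); apply: eq_bigl => i; rewrite inE.
Qed.

Lemma block_proj_coef J k i f : i \in J -> block_proj J (T k i f) = T k i f.
Proof.
move=> Ji; apply/funext => z; rewrite /block_proj (bigD1 i) //= big1 ?addr0.
  by rewrite coef_op_mul eqxx.
by move=> j /andP[_ ji]; rewrite coef_op_mul (negPf ji).
Qed.

Lemma block_proj_sum J (I : Type) (r : seq I) (P : pred I) (c : I -> C)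
    (F : I -> 'cV[C]_n -> C) :
  block_proj J (fun z => \sum_(a <- r | P a) c a * F a z) =
  (fun z => \sum_(a <- r | P a) c a * block_proj J (F a) z).
Proof.
apply/funext => z; rewrite /block_proj.
under eq_bigr do rewrite coef_op_sum.
by rewrite exchange_big /=; apply: eq_bigr => a _; rewrite mulr_sumr.
Qed.

Lemma block_proj_idem J f : block_proj J (block_proj J f) = block_proj J f.
Proof.
have -> : block_proj J f = (fun z => \sum_(i in J) 1 * T i i f z).
  by apply/funext => z; apply: eq_bigr => i _; rewrite mul1r.
rewrite block_proj_sum; apply/funext => z; apply: eq_bigr => i Ji.
by rewrite block_proj_coef.
Qed.

Lemma block_proj_lin J a f g :
  block_proj J (a \*o f \+ g) = a \*o block_proj J f \+ block_proj J g.
Proof.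
apply/funext => z; rewrite /block_proj /= mulr_sumr -big_split.
by apply: eq_bigr => i _; rewrite coef_op_lin.
Qed.

Lemma block_proj_invariant J p f : invariant_poly rG p ->
  block_proj J (peval p \* f) = peval p \* block_proj J f.
Proof.
move=> ip; apply/funext => z; rewrite /block_proj /= mulr_sumr.
by apply: eq_bigr => i _; rewrite coef_op_invariant.
Qed.

Lemma block_proj_gcomp J s f z : s \in G ->
  block_proj J (gcomp rG s^-1%g f) z =
  \sum_(i in J) \sum_k rho s i k * T k i f z.
Proof. by move=> Gs; apply: eq_bigr => i _; rewrite coef_op_gcomp. Qed.

Hypothesis hinv : invariant_domain rG Omega.
Hypothesis hH : analytic_hilbert_module H K.
Hypothesis hK : invariant_kernel rG Omega K.
Let hrep := module_kernel hH.

Lemma hcarrier_block_proj J f : HH f -> HH (block_proj J f).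
Proof.
move=> Hf; have -> : block_proj J f = (fun z => \sum_(i in J) 1 * T i i f z).
  by apply/funext => z; apply: eq_bigr => i _; rewrite mul1r.
by apply: hcarrier_sum => i _; exact: (hcarrier_coef_op hinv hrep hK).
Qed.

Lemma block_proj_adjoint J f g : HH f -> HH g ->
  << block_proj J f, g >> = << f, block_proj J g >>.
Proof.
have sum1 h : block_proj J h = (fun z => \sum_(i in J) 1 * T i i h z).
  by apply/funext => z; apply: eq_bigr => i _; rewrite mul1r.
have HT i h : HH h -> HH (T i i h) by move=> Hh; exact: (hcarrier_coef_op hinv hrep hK).
move=> Hf Hg; rewrite !sum1 hinner_suml // => [|i _]; last exact: HT.
rewrite hinner_sumr // => [|i _]; last exact: HT.
by apply: eq_bigr => i _; rewrite rmorph1 (coef_op_adjoint hinv hrep hK).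
Qed.

Lemma block_rangeP J f : (block_proj J @` HH) f <-> HH f /\ block_proj J f = f.
Proof.
split=> [[g Hg <-]|[Hf Jf]]; last by exists f.
by rewrite block_proj_idem; split=> //; exact: hcarrier_block_proj.
Qed.

Lemma block_submodule J : invariant_submodule rG H (block_proj J @` HH).
Proof.
split.
- by move=> f /block_rangeP[].
- apply/block_rangeP; split; first exact: hzero.
  apply/funext => z.
  rewrite /block_proj big1 // => i _.
  by rewrite /coef_op big1 ?mulr0 // => s _; rewrite mulr0.
- move=> a f g /block_rangeP[Hf Jf] /block_rangeP[Hg Jg]; apply/block_rangeP.
  by rewrite block_proj_lin Jf Jg; split=> //; exact: hlin.
- move=> p f ip /block_rangeP[Hf Jf]; apply/block_rangeP.
  by rewrite block_proj_invariant // Jf; split=> //; exact: (hcarrier_mul hH).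
Qed.

Variables (w : 'cV[C]_n) (L : 'cV[C]_n -> C).
Hypothesis Ow : Omega w.
Hypothesis polyL : polyfun L.
Hypothesis linj : {in G &, injective (fun s => L (rG s *m w))}.

Let HKw : HH (K^~ w). Proof. exact: (hcarrier_kernel hrep). Qed.
Let HT (i j : 'I_d) f : HH f -> HH (T i j f).
Proof. by move=> Hf; exact: (hcarrier_coef_op hinv hrep hK). Qed.

Definition block_kernel J (ka : 'I_d * 'I_#|J|) : 'cV[C]_n -> C :=
  T ka.1 (enum_val ka.2) (K^~ w).

(** The coordinate along T k i (K^~ w) is read off by pairing with a polynomial
   whose values on the orbit of w are the matrix coefficients of rho at (k, i). *)
Lemma block_kernel_free J : free_family (@block_kernel J).
Proof.
move=> c c0 [k0 a0]; set i0 := enum_val a0.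
have [q Pq qE] := orbit_interpolate polyL linj (fun s => rho s^-1%g k0 i0).
have Hq := hcarrier_poly hH Pq.
have HB ka : HH (@block_kernel J ka) by exact: HT.
have dual ka : << block_kernel ka, q \_ Omega >> = (ka == (k0, a0))%:R.
  case: ka => k a; rewrite /block_kernel /= (coef_op_adjoint hinv hrep hK) //.
  rewrite (hinner_kernell hrep Ow (HT _ _ Hq)) /coef_op.
  rewrite (eq_bigr (fun s => rho s^-1%g (enum_val a) k * rho s k0 i0)) => [|s Gs].
    rewrite schur_orthogonality mulrnAr rmorphMn /= mulrA divfK ?card_group_neq0 //.
    rewrite divff ?irr_deg_neq0 // rmorph1 xpair_eqE andbC.
    by rewrite /i0 (inj_eq enum_val_inj).
  have Osw : Omega (rG s^-1%g *m w) by apply/(domain_act hinv); rewrite ?groupV.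
  by rewrite (restrictE _ Osw) qE ?groupV // invgK.
have : << lincomb c (@block_kernel J), q \_ Omega >> = 0 by rewrite c0 hinner0l.
rewrite hinner_suml // (bigD1 (k0, a0)) //= dual eqxx mulr1 big1 ?addr0 //.
by move=> ka /negPf kaN; rewrite dual kaN mulr0.
Qed.

Lemma block_kernel_basis J :
  basis_family (joint_eigenspace rG H (block_proj J @` HH) w) (@block_kernel J).
Proof.
split; first exact: block_kernel_free.
  move=> [k a]; rewrite /block_kernel /=; set i := enum_val a.
  have Ji : i \in J by exact: enum_valP.
  split; first by apply/block_rangeP; rewrite block_proj_coef //; split=> //; exact: HT.
  move=> p g ip /block_rangeP[Hg _]; have Hpg := hcarrier_mul hH p Hg.
  rewrite -!(coef_op_adjoint hinv hrep hK) // coef_op_invariant //.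
  have HTg := HT i k Hg; have HpTg := hcarrier_mul hH p HTg.
  by rewrite !(hinner_kernel hrep Ow).
move=> f [/block_rangeP[Hf Jf] Vf].
have VHf : joint_eigenspace rG H HH w f.
  split=> // p g ip Hg; have Hpg := hcarrier_mul hH p Hg.
  by rewrite -Jf -!block_proj_adjoint // block_proj_invariant // Vf.
have [c fE] := eigenspace_kernel_span hinv hH Ow polyL linj VHf.
exists (fun ka => \sum_(s in G) c s * rho s (enum_val ka.2) ka.1).
rewrite -Jf [in LHS]fE block_proj_sum; apply/funext => z.
have eqs s : s \in G -> c s * block_proj J (K^~ (rG s *m w)) z =
    \sum_(ka : 'I_d * 'I_#|J|) c s * rho s (enum_val ka.2) ka.1 * block_kernel ka z.
  move=> Gs; have Gs' := groupVr Gs.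
  have -> : K^~ (rG s *m w) = gcomp rG s^-1%g (K^~ w).
    by rewrite (gcomp_kernel hinv hrep hK) // invgK.
  rewrite block_proj_gcomp // big_enum_val exchange_big pair_big /= mulr_sumr.
  by apply: eq_bigr => -[k a] _; rewrite mulrA.
rewrite (eq_bigr _ eqs) exchange_big /lincomb; apply: eq_bigr => ka _.
by rewrite mulr_suml.
Qed.

End BlockProjection.

(** * Unitary equivalence of the submodules *)

Section Equivalence.
Variables (R : realType) (n : nat) (gT : finGroupType) (G : {group gT}).
Variables (rG : mx_representation (CC R) G n).
Variables (Omega : set 'cV[CC R]_n) (H : hilbert_fun_space Omega).
Variable (K : 'cV[CC R]_n -> 'cV[CC R]_n -> CC R).
Local Notation C := (CC R).
Hypothesis faith : mx_faithful rG.
Hypothesis oOmega : open Omega.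
Hypothesis Omega0 : Omega !=set0.
Hypothesis hinv : invariant_domain rG Omega.
Hypothesis hH : analytic_hilbert_module H K.
Hypothesis hK : invariant_kernel rG Omega K.

(** By faithfulness the differences rG s - rG t are nonzero matrices, so a
   general linear form l keeps them nonzero, and a general point then avoids the
   zero hyperplanes of the forms l (rG s - rG t). *)
Lemma exists_separated_orbit : exists w (L : 'cV[C]_n -> C),
  [/\ Omega w, polyfun L & {in G &, injective (fun s => L (rG s *m w))}].
Proof.
pose P (st : gT * gT) := [&& st.1 \in G, st.2 \in G & st.1 != st.2].
have [|l lP] := @separating_row R n n _ P (fun st => rG st.1 - rG st.2).
  move=> [s t] /and3P[/= Gs Gt]; apply: contra_neq => /subr0_eq.
  exact: (mx_faithful_inj faith).
have [w Ow wP] := open_general_point oOmega Omega0 lP.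
exists w, (fun z => (l *m z) 0 0); split=> //; first exact: polyfun_linear.
move=> s t Gs Gt /= e; apply/eqP; apply: contraT => st.
have /eqP[] := wP (s, t) (introT and3P (And3 Gs Gt st)).
apply/eqP; rewrite mulmxBr mulmxBl subr_eq0; apply/eqP/matrixP => x y.
by rewrite !ord1 -!mulmxA; exact: e.
Qed.

Lemma equivalent_block_card (rho rho' : unitary_irrep R G)
    (J : {set 'I_(irr_deg rho)}) (J' : {set 'I_(irr_deg rho')}) :
  unitarily_equivalent rG H
    (block_proj rG J @` hcarrier H) (block_proj rG J' @` hcarrier H) ->
  (irr_deg rho * #|J| = irr_deg rho' * #|J'|)%N.
Proof.
have [w [L [Ow polyL linj]]] := exists_separated_orbit => UJ.
have := equivalent_eigenspace_card (block_submodule hinv hH hK J)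
  (block_submodule hinv hH hK J') UJ
  (block_kernel_basis hinv hH hK Ow polyL linj J)
  (block_kernel_basis hinv hH hK Ow polyL linj J').
by rewrite !card_prod !card_ord.
Qed.

(** The coefficient operator T i j maps the range of T i i onto that of T j j,
   with inverse and adjoint T j i. *)
Lemma diag_proj_equivalent (rho : unitary_irrep R G) (i j : 'I_(irr_deg rho)) :
  unitarily_equivalent rG H
    (diag_proj rG i @` hcarrier H) (diag_proj rG j @` hcarrier H).
Proof.
have hrep := module_kernel hH.
have TTf (k l m : 'I_(irr_deg rho)) f :
    coef_op rG k l (coef_op rG m k f) = coef_op rG m l f.
  by rewrite coef_op_mul eqxx; apply/funext => z; rewrite mulr1n.
have HT (k l : 'I_(irr_deg rho)) f : hcarrier H f -> hcarrier H (coef_op rG k l f).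
  exact: (hcarrier_coef_op hinv hrep hK).
have HD f : (diag_proj rG i @` hcarrier H) f -> hcarrier H f.
  by move=> [g Hg <-]; exact: HT.
exists (coef_op rG i j); split.
- apply/seteqP; split=> [_ [_ [f Hf <-] <-]|_ [f Hf <-]].
    exists (coef_op rG i j f); first exact: HT.
    by rewrite [LHS](TTf j j i) (TTf i j i).
  exists (diag_proj rG i (coef_op rG j i f)).
    by exists (coef_op rG j i f) => //; exact: HT.
  by rewrite [diag_proj rG i _](TTf i i j) (TTf i j j).
- by move=> a f g _ _; exact: coef_op_lin.
- move=> f g [f' Hf' <-] /HD Hg; have HTg := HT i j g Hg.
  rewrite [coef_op rG i j _](TTf i j i) (coef_op_adjoint hinv hrep hK) // TTf.
  by rewrite -(coef_op_adjoint hinv hrep hK).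
- by move=> p f ip _; exact: coef_op_invariant.
Qed.

End Equivalence.

Theorem theorem6p10 (R : realType) (n : nat) (gT : finGroupType)
  (G : {group gT}) (rG : mx_representation (CC R) G n)
  (Omega : set 'cV[CC R]_n) (H : hilbert_fun_space Omega)
  (K : 'cV[CC R]_n -> 'cV[CC R]_n -> CC R)
  (hG : pseudoreflection_group rG)
  (hOmega : complex_domain Omega) (hbound : bounded_set Omega)
  (hinv : invariant_domain rG Omega)
  (hH : analytic_hilbert_module H K)
  (hK : invariant_kernel rG Omega K) :
  (forall rho rho' : unitary_irrep R G, irr_deg rho <> irr_deg rho' ->
     ~ unitarily_equivalent rG H
         (isotypic_proj rG rho @` hcarrier H) (isotypic_proj rG rho' @` hcarrier H) /\
     forall (i : 'I_(irr_deg rho)) (j : 'I_(irr_deg rho')),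
       ~ unitarily_equivalent rG H
           (diag_proj rG i @` hcarrier H) (diag_proj rG j @` hcarrier H)) /\
  (forall (rho : unitary_irrep R G) (i j : 'I_(irr_deg rho)),
     unitarily_equivalent rG H
       (diag_proj rG i @` hcarrier H) (diag_proj rG j @` hcarrier H)).
Proof.
have [faith _] := hG; have [oOmega _ Omega0] := hOmega.
have eq_card := equivalent_block_card faith oOmega Omega0 hinv hH hK.
split=> [rho rho' dNd'|rho i j]; last exact: (diag_proj_equivalent hinv hH hK).
split=> [|i j]; last first.
  by rewrite -!block_proj1 => /eq_card; rewrite !cards1 !muln1.
rewrite -!block_projT => /eq_card; rewrite !cardsT !card_ord => /eqP.
by rewrite !mulnn eqn_sqr => /eqP.
Qed.
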